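(* If $(X,\leq)$ is a quasiordered set, then the DR-semigroup $P_{SO}(X)$ satisfies the ample conditions, i.e. $se=D(se)s$ and $es=sR(es)$ for all $s\in P_{SO}(X)$ and $e\in D(P_{SO}(X))$.
   Context: A quasiorder is a reflexive transitive relation. For $T\subseteq X$, let $C(T)=\{y\in X\mid y\leq x\text{ for some }x\in T\}$ be the down-set generated by $T$. A partial function $f$ on $X$ is strongly order-preserving if for all $x,y\in\mathrm{dom}(f)$, $x\leq y\Leftrightarrow f(x)\leq f(y)$. $P_{SO}(X)$ is the set of all strongly order-preserving partial functions on $X$, a semigroup under composition of partial functions, where products are read left to right: $fg$ means first $f$, then $g$. For $f\in P_{SO}(X)$, $D(f)$ is the restriction of the identity map to $C(\mathrm{dom}(f))$, and $R(f)$ is the restriction of the identity map to $C(\mathrm{im}(f))$. Put $D(P_{SO}(X))=\{D(f)\mid f\in P_{SO}(X)\}$. A DR-semigroup is a semigroup $S$ with two unary operations $D,R$ satisfying the laws: (DR1) $D(x)x=x$; (DR2) $xR(x)=x$; (DR3) $R(D(x))=D(x)$, $D(R(x))=R(x)$; (DR4) $D(x)D(xy)=D(xy)D(x)=D(xy)$; (DR5) $R(y)R(xy)=R(xy)R(y)=R(xy)$. With the operations above, $P_{SO}(X)$ is a DR-semigroup. *)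

(* Defs.v *)
From HB Require Import structures.
From mathcomp Require Import all_boot all_order.
From mathcomp Require Import boolp classical_sets.
Set Implicit Arguments.
Unset Strict Implicit.
Unset Printing Implicit Defensive.
Import Order.TTheory.
Local Open Scope classical_set_scope.
Local Open Scope order_scope.
Local Open Scope group_scope.

HB.mixin Record Semigroup_isDR S of Semigroup S := {
  DRdom : S -> S;
  DRran : S -> S;
  DR1 : forall x : S, DRdom x * x = x;
  DR2 : forall x : S, x * DRran x = x;
  DR3 : forall x : S, DRran (DRdom x) = DRdom x /\ DRdom (DRran x) = DRran x;
  DR4 : forall x y : S, DRdom x * DRdom (x * y) = DRdom (x * y) /\
                        DRdom (x * y) * DRdom x = DRdom (x * y);
  DR5 : forall x y : S, DRran y * DRran (x * y) = DRran (x * y) /\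
                        DRran (x * y) * DRran y = DRran (x * y) }.

#[short(type="drSemigroupType")]
HB.structure Definition DRSemigroup := { S of Semigroup_isDR S & Semigroup S }.

Definition ample (S : drSemigroupType) : Prop :=
  forall s e : S, range (@DRdom S) e ->
    s * e = DRdom (s * e) * s /\ e * s = s * DRran (e * s).

Section StronglyOrderPreserving.
Context {d : Order.disp_t} {X : preorderType d}.
Implicit Types (A : set X) (f g : X -> option X).

(* The library's [down] is restricted to partial orders. *)
Definition downset A : set X := [set y | exists2 x, A x & y <= x].

(* A partial function is a map to [option X]; [None] means undefined. *)
Definition pdom f : set X := [set x | exists y, f x = Some y].
Definition pim f : set X := [set y | exists x, f x = Some y].

Definition strongly_op f : Prop :=
  forall x y x' y', f x = Some x' -> f y = Some y' -> (x <= y <-> x' <= y').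

Definition pid A : X -> option X := fun x => if `[< A x >] then Some x else None.

Lemma pidP A x y : pid A x = Some y <-> A x /\ x = y.
Proof.
rewrite /pid; case: asboolP => Ax; split=> //.
- by case.
- by case=> _ ->.
- by case.
Qed.

Lemma strongly_op_pid A : strongly_op (pid A).
Proof. by move=> x y x' y' /pidP[_ <-] /pidP[_ <-]. Qed.

Lemma pcompP f g x z :
  pcomp g f x = Some z <-> exists2 y, f x = Some y & g y = Some z.
Proof.
rewrite /pcomp; case fx: (f x) => [y|] /=; split=> //.
- by exists y.
- by case=> y' [<-].
- by case.
Qed.

Lemma strongly_op_pcomp f g :
  strongly_op f -> strongly_op g -> strongly_op (pcomp g f).
Proof.
move=> fP gP x y x' y' /pcompP[u fx gu] /pcompP[v fy gv].
by rewrite (fP _ _ _ _ fx fy); apply: gP.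
Qed.

Lemma pfun_ext f g : (forall x y, f x = Some y <-> g x = Some y) -> f = g.
Proof.
move=> fg; apply/funext => x; case fx: (f x) => [y|]; first by rewrite (fg x y).1.
by case gx: (g x) => [y|] //; move: fx; rewrite (fg x y).2.
Qed.

Lemma sub_downset A : A `<=` downset A.
Proof. by move=> x Ax; exists x. Qed.

Lemma downset_id A : downset (downset A) = downset A.
Proof.
apply/seteqP; split; last exact: sub_downset.
by move=> x [y [z Az yz] xy]; exists z => //; apply: le_trans yz.
Qed.

Lemma downset_sub A B : A `<=` B -> downset A `<=` downset B.
Proof. by move=> AB x [y /AB By xy]; exists y. Qed.

Lemma pdom_pid A : pdom (pid A) = A.
Proof.
apply/seteqP; split=> x; first by case=> y /pidP[].
by move=> Ax; exists x; apply/pidP.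
Qed.

Lemma pim_pid A : pim (pid A) = A.
Proof.
apply/seteqP; split=> x; first by case=> y /pidP[Ay <-].
by move=> Ax; exists x; apply/pidP.
Qed.

Lemma pcomp_pid A B : pcomp (pid B) (pid A) = pid (A `&` B).
Proof.
apply: pfun_ext => x z; split.
  by move=> /pcompP[y /pidP[Ax <-] /pidP[Bx <-]]; apply/pidP.
by move=> /pidP[[Ax Bx] <-]; apply/pcompP; exists x; apply/pidP.
Qed.

Lemma pcomp_pidl A f : pdom f `<=` A -> pcomp f (pid A) = f.
Proof.
move=> fA; apply: pfun_ext => x z; split.
  by move=> /pcompP[y /pidP[_ <-]].
by move=> fx; apply/pcompP; exists x => //; apply/pidP; split=> //; apply: fA; exists z.
Qed.

Lemma pcomp_pidr A f : pim f `<=` A -> pcomp (pid A) f = f.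
Proof.
move=> fA; apply: pfun_ext => x z; split.
  by move=> /pcompP[y fx /pidP[_ <-]].
by move=> fx; apply/pcompP; exists z => //; apply/pidP; split=> //; apply: fA; exists x.
Qed.

Lemma pdom_pcomp f g : pdom (pcomp g f) `<=` pdom f.
Proof. by move=> x [z /pcompP[y fx _]]; exists y. Qed.

Lemma pim_pcomp f g : pim (pcomp g f) `<=` pim g.
Proof. by move=> z [x /pcompP[y _ gy]]; exists y. Qed.

End StronglyOrderPreserving.

Record PSO {d : Order.disp_t} (X : preorderType d) : Type := MkPSO {
  pso_fun :> X -> option X;
  psoP : strongly_op pso_fun }.

Section PSODRSemigroup.
Context {d : Order.disp_t} {X : preorderType d}.
Implicit Types f g h : PSO X.

HB.instance Definition _ := gen_eqMixin (PSO X).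
HB.instance Definition _ := gen_choiceMixin (PSO X).

Lemma pso_ext f g : pso_fun f = pso_fun g -> f = g.
Proof. by case: f g => [f fP] [g gP] /= fg; subst g; congr MkPSO. Qed.

(* Products are read left to right: first [f], then [g]. *)
Definition pso_mul f g : PSO X := MkPSO (strongly_op_pcomp (@psoP _ _ f) (@psoP _ _ g)).

Definition pso_D f : PSO X := MkPSO (@strongly_op_pid _ _ (downset (pdom f))).
Definition pso_R f : PSO X := MkPSO (@strongly_op_pid _ _ (downset (pim f))).

Lemma pso_mulA : associative pso_mul.
Proof. by move=> f g h; apply/pso_ext/funext => x; rewrite /= /pcomp; case: (pso_fun f x). Qed.

HB.instance Definition _ := isSemigroup.Build (PSO X) pso_mulA.

Lemma pso_DR1 f : pso_D f * f = f.
Proof. by apply/pso_ext/pcomp_pidl/sub_downset. Qed.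

Lemma pso_DR2 f : f * pso_R f = f.
Proof. by apply/pso_ext/pcomp_pidr/sub_downset. Qed.

Lemma pso_DR3 f : pso_R (pso_D f) = pso_D f /\ pso_D (pso_R f) = pso_R f.
Proof. by split; apply/pso_ext; rewrite /= ?pim_pid ?pdom_pid downset_id. Qed.

Lemma pso_DR4 f g : pso_D f * pso_D (f * g) = pso_D (f * g) /\
                    pso_D (f * g) * pso_D f = pso_D (f * g).
Proof.
have sub := downset_sub (@pdom_pcomp _ _ (pso_fun f) (pso_fun g)).
by split; apply/pso_ext; rewrite /= pcomp_pid ?(setIidl sub) ?(setIidr sub).
Qed.

Lemma pso_DR5 f g : pso_R g * pso_R (f * g) = pso_R (f * g) /\
                    pso_R (f * g) * pso_R g = pso_R (f * g).
Proof.
have sub := downset_sub (@pim_pcomp _ _ (pso_fun f) (pso_fun g)).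
by split; apply/pso_ext; rewrite /= pcomp_pid ?(setIidl sub) ?(setIidr sub).
Qed.

HB.instance Definition _ := Semigroup_isDR.Build (PSO X)
  pso_DR1 pso_DR2 pso_DR3 pso_DR4 pso_DR5.

End PSODRSemigroup.

(* Main.v *)
Require Import Defs.
From mathcomp Require Import all_boot all_order.
From mathcomp Require Import boolp classical_sets.

(** The elements of D(P_SO(X)) are the identities on down-sets A.  Restricting
    s to the points whose value lies in A always restricts it to a subset of
    the domain; since s preserves the order, that subset is downward closed
    within dom s, so restricting s to the down-set it generates keeps no other
    point.  Dually, since s reflects the order, the image under s of a
    down-set is downward closed within im s, so cutting s at the down-set
    generated by that image has the same effect as restricting the domain.
    Each ample identity thus uses one half of strong order preservation:
    [pcomp_pid_downset_pdom] the first, [pcomp_pid_downset_pim] the second. *)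

Set Implicit Arguments.
Unset Strict Implicit.
Unset Printing Implicit Defensive.
Import Order.TTheory.
Local Open Scope classical_set_scope.
Local Open Scope order_scope.
Local Open Scope group_scope.

Section RestrictionToDownSets.
Context {d : Order.disp_t} {X : preorderType d}.
Implicit Types (A : set X) (f : X -> option X).

(** If x lies below some y with f y in A, then f x <= f y puts f x in A too:
    the preimage of a down-set is downward closed within the domain. *)
Lemma pcomp_pid_downset_pdom f A :
    (forall x y x' y', f x = Some x' -> f y = Some y' -> x <= y -> x' <= y') ->
    downset A `<=` A ->
  pcomp (pid A) f = pcomp f (pid (downset (pdom (pcomp (pid A) f)))).
Proof.
move=> f_homo dA; apply: pfun_ext => x z; split.
  move=> fAx; apply/pcompP; exists x.
    by apply/pidP; split=> //; apply: sub_downset; exists z.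
  by case/pcompP: fAx => y fx /pidP[_ <-].
move=> /pcompP[_ /pidP[[y [w /pcompP[y' fy /pidP[Ay' _]]] xy] <-] fx].
apply/pcompP; exists z => //; apply/pidP; split=> //.
by apply: dA; exists y' => //; apply: f_homo xy.
Qed.

(** If f x lies below some f y with y in A, then x <= y puts x in A too: the
    image of a down-set is downward closed within the image of f. *)
Lemma pcomp_pid_downset_pim f A :
    (forall x y x' y', f x = Some x' -> f y = Some y' -> x' <= y' -> x <= y) ->
    downset A `<=` A ->
  pcomp f (pid A) = pcomp (pid (downset (pim (pcomp f (pid A))))) f.
Proof.
move=> f_refl dA; apply: pfun_ext => x z; split.
  move=> fAx; apply/pcompP; exists z.
    by case/pcompP: fAx => y /pidP[_ <-].
  by apply/pidP; split=> //; apply: sub_downset; exists x.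
move=> /pcompP[y fx /pidP[[w [u /pcompP[_ /pidP[Au <-] fu]] yw] <-]].
apply/pcompP; exists x => //; apply/pidP; split=> //.
by apply: dA; exists u => //; apply: f_refl yw.
Qed.

End RestrictionToDownSets.

Theorem proposition3p1 (d : Order.disp_t) (X : preorderType d) : ample (PSO X).
Proof.
move=> s _ [f _ <-].
have dA : downset (downset (pdom f)) `<=` downset (pdom f).
  by rewrite downset_id.
split; apply: pso_ext.
  apply: pcomp_pid_downset_pdom dA => x y x' y' sx sy.
  by rewrite (psoP sx sy).
apply: pcomp_pid_downset_pim dA => x y x' y' sx sy.
by rewrite (psoP sx sy).
Qed.
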